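(* For any integer $t\ge 1$ and any prime $p>t$, $$H_{p-1}^q(\{2\}^t)\equiv (-1)^t\binom{p+t}{2t+1}\frac{(1-q)^{2t}}{p(t+1)} \pmod{[p]_q}.$$
   Context: Here $q$ is an indeterminate and $[n]_q=\frac{1-q^n}{1-q}=1+q+\cdots+q^{n-1}$. For positive integers $s_1,\dots,s_l$, $$H_n^q(s_1,\ldots,s_l)=\sum_{1\le k_1<\cdots<k_l\le n}\prod_{i=1}^l\frac{q^{(s_i-1)k_i}}{[k_i]_q^{s_i}}.$$ $\{s\}^t$ denotes $t$ consecutive copies of $s$. For a prime $p$ and rational functions $A,B$ in $q$, $A\equiv B\pmod{[p]_q}$ means $A-B=f/g$ with $f,g$ polynomials in $q$ with integer coefficients, $g$ coprime to $[p]_q$ in $\mathbb{Q}[q]$, and $[p]_q\mid f$ ($[p]_q$ is the $p$th cyclotomic polynomial, irreducible over $\mathbb{Q}$). *)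

(* Defs.v *)
From HB Require Import structures.
From mathcomp Require Import all_boot all_order all_algebra.

Set Implicit Arguments.
Unset Strict Implicit.
Unset Printing Implicit Defensive.

Import GRing.Theory.
Local Open Scope ring_scope.

(* Rational functions in the indeterminate q: the fraction field of Z[q],
   that is Q(q). *)
Notation ratfun := {fraction {poly int}}.

Definition qvar : ratfun := tofrac 'X.

Definition qnat_poly (n : nat) : {poly int} := \sum_(i < n) 'X^i.

Definition qnat (n : nat) : ratfun := tofrac (qnat_poly n).

(* The condition [path ltn 0 k] reads 0 < k_1 < ... < k_l, and k_i <= n comes
   from the type 'I_n.+1.  The exponent [(s_i).-1] is s_i - 1 for the positive
   s_i that are considered. *)
Definition qmhs (n l : nat) (s : l.-tuple nat) : ratfun :=
  \sum_(k : l.-tuple 'I_n.+1 | path ltn 0 (map val k))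
    \prod_(i < l)
      (qvar ^+ ((tnth s i).-1 * tnth k i) / qnat (tnth k i) ^+ tnth s i).

Definition to_Qpoly (f : {poly int}) : {poly rat} := map_poly intr f.

(* Coprimality and divisibility are taken in Q[q]; for a monic modulus such as
   [p]_q, divisibility of an integral f in Q[q] and in Z[q] agree. The condition
   g != 0 follows from coprimality unless m is a nonzero constant. *)
Definition ratfun_eqmod (m : {poly int}) (A B : ratfun) : Prop :=
  exists f g : {poly int},
    [/\ g != 0,
        A - B = tofrac f / tofrac g,
        coprimep (to_Qpoly g) (to_Qpoly m)
      & to_Qpoly m %| to_Qpoly f].

(* Main.v *)
(* Evaluate at a primitive p-th root of unity z, whose minimal polynomial is
   [p]_q.  The left-hand side becomes (1 - z)^(2t) times the t-th elementary
   symmetric function of the numbers z^k / (1 - z^k)^2, 0 < k < p, that is, the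
   coefficient of x^t in
     prod_k (1 + x z^k / (1 - z^k)^2) = p^-2 prod_k ((1 - z^k)^2 + x z^k).
   With x = 2 - u - 1/u the factors are (u - z^k)(1/u - z^k), so that
   multiplying by the factor x for k = 0 gives (u^p - 1)(u^-p - 1)
   = 2 - u^p - u^-p = 2 - 2 T_p(1 - x/2), T_p being the Chebyshev polynomial,
   whose coefficients are explicit. *)
Require Import Defs.
From HB Require Import structures.
From mathcomp Require Import all_boot all_order all_algebra.
From mathcomp Require Import all_field ring zify.

Set Implicit Arguments.
Unset Strict Implicit.
Unset Printing Implicit Defensive.

Import GRing.Theory.
Local Open Scope ring_scope.

(** * Multiple sums over increasing tuples as elementary symmetric functions *)

Lemma sorted_enum_ord n (A : {set 'I_n}) : sorted ltn (map val (enum A)).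
Proof.
rewrite -[enum _](eq_filter (mem_enum _)).
rewrite -(eq_filter (mem_map val_inj _)) -filter_map.
by rewrite (sorted_filter ltn_trans) // -enumT val_enum_ord iota_ltn_sorted.
Qed.

(** A strictly increasing tuple is determined by its set of entries, and [enum] lists a set in
    increasing order; starting the path at 0 excludes the entry [ord0]. *)
Lemma sum_ltn_tuples (R : comNzRingType) n t (F : 'I_n.+1 -> R) :
  \sum_(k : t.-tuple 'I_n.+1 | path ltn 0 (map val k)) \prod_(i < t) F (tnth k i)
  = \sum_(A : {set 'I_n.+1} | (#|A| == t) && (ord0 \notin A)) \prod_(i in A) F i.
Proof.
(* [totuple] takes its default value, the zero tuple, only on sets whose cardinality is not [t]. *)
pose toset (k : t.-tuple 'I_n.+1) := [set i in k].
pose totuple (A : {set 'I_n.+1}) := insubd [tuple of nseq t ord0] (enum A).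
have totupleE (A : {set 'I_n.+1}) : #|A| = t -> val (totuple A) = enum A.
  by move=> At; rewrite val_insubd -cardE At eqxx.
rewrite [RHS](reindex_onto toset totuple) => [|A /andP[/eqP At _]]; last first.
  by apply/setP=> x; rewrite inE -(mem_enum A) -totupleE.
have pathE (s : seq 'I_n.+1) :
    path ltn 0 (map val s) = (ord0 \notin s) && sorted ltn (map val s).
  rewrite (path_sortedE ltn_trans); congr andb.
  apply/allP/idP => [s_gt0 | s0 _ /mapP[i si ->]].
    by apply/negP=> s0; have /= := s_gt0 0%N (map_f val s0).
  rewrite /= lt0n; apply: contraNneq s0 => i0.
  by rewrite (_ : ord0 = i) //; apply/val_inj.
apply: eq_big => [k|k]; rewrite pathE.
  rewrite inE; apply/andP/andP=> [[k0 inc_k]|[/andP[/eqP kt k0] /eqP <-]]; last first.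
    rewrite totupleE // mem_enum inE; split=> //; exact: sorted_enum_ord.
  have kt: #|toset k| = t.
    rewrite cardsE (card_uniqP _) ?size_tuple // -(map_inj_uniq val_inj).
    exact: (sorted_uniq ltn_trans ltnn).
  split; first by rewrite kt eqxx.
  rewrite -val_eqE totupleE // -(inj_eq (inj_map val_inj)).
  apply/eqP/(irr_sorted_eq ltn_trans ltnn) => // [|y]; first exact: sorted_enum_ord.
  by apply/mapP/mapP=> [] [x k_x ->]; exists x; rewrite // mem_enum inE in k_x *.
case/andP=> _ /(sorted_uniq ltn_trans ltnn); rewrite (map_inj_uniq val_inj) => uniq_k.
rewrite -(big_tuple _ _ k predT F) -big_enum /= (perm_big (enum (toset k))) //.
apply: uniq_perm; rewrite ?enum_uniq // => i.
by rewrite mem_enum inE.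
Qed.

(** When the product is expanded, [A] is the set of factors contributing their ['X] term, so only
    sets of size [t] reach degree [t]. *)
Lemma coef_prod_1DX (R : comNzRingType) (I : finType) (P : pred I) (F : I -> R) t :
  (\prod_(i | P i) (1 + F i *: 'X))`_t
  = \sum_(A : {set I} | (#|A| == t) && (A \subset P)) \prod_(i in A) F i.
Proof.
rewrite (eq_bigr (fun i => F i *: 'X + 1)) => [|i _]; last by rewrite addrC.
rewrite big_mkcond (eq_bigr (fun i => (if P i then F i else 0) *: 'X + 1)) /=;
  last first.
  by move=> i _; case: (P i); rewrite ?scale0r ?add0r.
rewrite bigA_distr coef_sum big_mkcond [RHS]big_mkcond /=.
apply: eq_bigr => A _.
rewrite -big_mkcond /= scaler_prod prodr_const coefZ coefXn eq_sym.
case: eqP => _ /=; rewrite ?mulr0 // mulr1.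
case: ifP => [/subsetP sAP | /subsetPn[i iA nPi]].
  by apply: eq_bigr => i /sAP; rewrite unfold_in => ->.
by rewrite (bigD1 i) //= unfold_in in nPi *; rewrite (negPf nPi) mul0r.
Qed.

Lemma sum_ltn_tuplesE (R : comNzRingType) n t (F : 'I_n.+1 -> R) :
  \sum_(k : t.-tuple 'I_n.+1 | path ltn 0 (map val k)) \prod_(i < t) F (tnth k i)
  = (\prod_(i | i != ord0) (1 + F i *: 'X))`_t.
Proof.
rewrite sum_ltn_tuples coef_prod_1DX; apply: eq_bigl => A; congr andb.
apply/idP/subsetP => [A0 i iA | sA]; last by apply/negP=> /sA; rewrite unfold_in eqxx.
by rewrite unfold_in; apply: contraNneq A0 => <-.
Qed.

(** * The Chebyshev polynomials and their coefficients *)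

(* [dcheb R n] is 2 - 2 T_n(1 - 'X / 2); see [dcheb_eval]. *)
Fixpoint dcheb_pair (R : nzRingType) (n : nat) : {poly R} * {poly R} :=
  if n is m.+1 then
    let: (a, b) := dcheb_pair R m in (b, 2%:R *: ('X + b) - 'X * b - a)
  else (0, 'X).
Definition dcheb (R : nzRingType) n := (dcheb_pair R n).1.

Section Dcheb.
Variable R : comNzRingType.

(** This is T_(n+2) = (2 - X) T_(n+1) - T_n, taken at 1 - X/2 and rewritten for 2 - 2 T_n. *)
Lemma dchebSS n :
  dcheb R n.+2 = 2%:R *: ('X + dcheb R n.+1) - 'X * dcheb R n.+1 - dcheb R n.
Proof. by rewrite /dcheb /=; case: (dcheb_pair R n). Qed.

(** Two Pascal steps. This second difference in the upper index is what [dchebSS] demands of the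
    coefficients. *)
Lemma bin_second_diff m k :
  ('C(m.+2, k.+2) + 'C(m, k.+2) = 2 * 'C(m.+1, k.+2) + 'C(m, k))%N.
Proof. by rewrite !binS; lia. Qed.

Lemma coef0_dcheb n : (dcheb R n)`_0 = 0.
Proof.
elim/ltn_ind: n => -[|[|n]] IH; rewrite ?coef0 ?coefX //.
by rewrite dchebSS !coefB coefZ coefD coefXM coefX /= !IH // addr0 mulr0 !subr0.
Qed.

(** The sum of two binomials avoids the division in [coef_dcheb_bin], so the induction works over
    any commutative ring. *)
Lemma coef_dcheb n j :
  (dcheb R n)`_j.+1 =
  (-1) ^+ j * ('C(n + j.+1, (2 * j).+2) + 'C(n + j, (2 * j).+2))%:R.
Proof.
elim/ltn_ind: n j => -[|[|n]] IH j.
- by rewrite coef0 !bin_small ?mulr0 //; lia.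
- rewrite coefX; case: j => [|j]; first by rewrite /= mul1r.
  by rewrite !bin_small ?mulr0 //; lia.
rewrite dchebSS !coefB coefZ coefD coefXM coefX /= !IH //; case: j => [|j].
  (* The linear coefficient is separate: [2%:R *: 'X] contributes to it, and the constant
     coefficient 0 is not covered by the formula. *)
  have := bin_second_diff n.+1 0; have := bin_second_diff n 0.
  rewrite coef0_dcheb !bin0 expr0 !mul1r muln0 !addn1 !addn0 /= => E1 E2.
  rewrite subr0; apply/eqP; rewrite subr_eq nat1r -natrM -natrD; apply/eqP.
  by congr (_%:R); lia.
rewrite IH // add0r !addSn !addnS (_ : 2 * j.+1 = (2 * j).+2)%N ?mulnS //.
have := bin_second_diff (n + j).+2 (2 * j).+2.
have := bin_second_diff (n + j).+1 (2 * j).+2.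
set a4 := 'C((n + j).+4, _); set a3 := 'C((n + j).+3, _).
set a2 := 'C((n + j).+2, _.+4); set a1 := 'C((n + j).+1, _.+4).
set b2 := 'C((n + j).+2, _); set b1 := 'C((n + j).+1, _) => E1 E2.
(* The two second differences are added in a form free of subtraction, so that the identity can be
   cast into [R]. *)
have /(congr1 (fun m => m%:R : R)) :
  (a4 + a3 + (a2 + a1) = (a3 + a2) + (a3 + a2) + (b2 + b1))%N by lia.
rewrite !natrD [LHS]addrA => /(canRL (addrK _))/(canRL (addrK _)) E.
by rewrite E exprS; ring.
Qed.

End Dcheb.

(** Both sides satisfy the same recurrence and agree for [n] equal to 0 and 1. *)
Lemma dcheb_eval (F : fieldType) n (u : F) : u != 0 ->
  (dcheb F n).[2%:R - u - u^-1] = 2%:R - u ^+ n - u^-1 ^+ n.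
Proof.
move=> u0; elim/ltn_ind: n => -[|[|n]] IH.
- by rewrite /dcheb /= horner0 !expr0; ring.
- by rewrite /dcheb /= hornerX !expr1.
rewrite dchebSS !hornerE !IH // !exprS.
by field.
Qed.

(** * Products over the powers of a primitive root of unity *)

(** A nonzero difference would have a nonroot [y]. But every [y] is 2 - u - 1/u for some nonzero
    [u], and there both sides equal (u^n - 1)(u^-n - 1). *)
Lemma prod_root_of_unity_quadratic (F : closedFieldType) n (z : F) :
    n.-primitive_root z ->
  \prod_(0 <= k < n) (((1 - z ^+ k) ^+ 2)%:P + z ^+ k *: 'X) = dcheb F n.
Proof.
move=> zP; apply/eqP; rewrite -subr_eq0.
apply/negP=> /negP/closed_nonrootP[y] /negP; apply.
(* [r] is X^2 + (y - 2) X + 1: a root [u] is nonzero because of the constant term, and dividing by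
   [u] gives y = 2 - u - 1/u. *)
pose r := \poly_(i < 3) [:: 1; y - 2%:R; 1]`_i.
have /closed_rootP[u] : size r != 1%N by rewrite size_poly_eq ?oner_neq0.
rewrite /root horner_poly !big_ord_recl big_ord0 /= => /eqP ru.
have {}ru : u ^+ 2 + (y - 2%:R) * u + 1 = 0 by rewrite -[RHS]ru /bump /=; ring.
have u0 : u != 0.
  by apply: contra_eq_neq ru => ->; rewrite expr0n /= mulr0 !add0r oner_eq0.
have uV : u * u^-1 = 1 by rewrite divff.
have -> : y = 2%:R - u - u^-1.
  by apply: (mulIf u0); apply/eqP; rewrite -subr_eq0 -[X in _ == X]ru; apply/eqP; field.
rewrite /root hornerD hornerN dcheb_eval // horner_prod.
have prodE v : \prod_(0 <= k < n) (v - z ^+ k) = v ^+ n - 1.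
  have := congr1 (horner^~ v) (factor_Xn_sub_1 zP).
  rewrite horner_prod !hornerE => <-; apply: eq_bigr => k _; by rewrite !hornerE.
rewrite (eq_bigr (fun k => (u - z ^+ k) * (u^-1 - z ^+ k))) => [|k _].
  rewrite big_split /= !prodE exprVn.
  by rewrite subr_eq0; apply/eqP; field; rewrite expf_neq0.
by rewrite !hornerE; field.
Qed.

(** Cancel X - 1 in the factorization of X^n - 1 and evaluate at 1. *)
Lemma prod_1subroot_of_unity (F : fieldType) n (z : F) : n.-primitive_root z ->
  \prod_(1 <= k < n) (1 - z ^+ k) = n%:R.
Proof.
move=> zP; have n0 := prim_order_gt0 zP.
have := factor_Xn_sub_1 zP; rewrite big_ltn // expr0 subrX1.
move/(mulfI (monic_neq0 (monicXsubC 1))) => /(congr1 (horner^~ 1)).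
rewrite horner_prod horner_sum [RHS](eq_bigr (fun _ => 1)) => [|i _]; last first.
  by rewrite hornerXn expr1n.
rewrite sumr_const card_ord => <-.
by apply: eq_bigr => i _; rewrite !hornerE.
Qed.

Lemma coef_dcheb_bin (F : numFieldType) n j :
  (dcheb F n)`_j.+1 = (-1) ^+ j * n%:R / j.+1%:R * 'C(n + j, 2 * j + 1)%:R.
Proof.
have nat_eq : (j.+1 * ('C(n + j.+1, (2 * j).+2) + 'C(n + j, (2 * j).+2))
     = n * 'C(n + j, 2 * j + 1))%N.
  have := mul_bin_diag (n + j.+1) (2 * j).+1; have := mul_bin_left (n + j) (2 * j).+1.
  rewrite addnS /= addn1.
  (* The natural subtraction from [mul_bin_left] truncates when n + j < 2j + 1, where all three
     binomials vanish. *)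
  have [lt|le] := ltnP (n + j) (2 * j).+1; first by rewrite !bin_small ?muln0; lia.
  nia.
rewrite coef_dcheb; have j0 : j.+1%:R != 0 :> F by rewrite Num.Theory.pnatr_eq0.
apply: (mulfI j0); rewrite mulrCA -natrM nat_eq natrM.
by move: (j.+1%:R) j0 => c c0; field.
Qed.

Lemma prim_root_1sub_neq0 (F : fieldType) n k (z : F) :
  n.-primitive_root z -> (0 < k < n)%N -> 1 - z ^+ k != 0.
Proof.
move=> zP /andP[k0 kn]; rewrite subr_eq0 eq_sym -(prim_order_dvd zP).
by apply/negP=> /(dvdn_leq k0); rewrite leqNgt kn.
Qed.

(** In the quadratic product the factor k = 0 is ['X], and clearing the denominators (1 - z^k)^2 of
    the others costs [n.+1%:R ^+ 2]. Hence degree [t] here is degree [t.+1] in [dcheb]. *)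
Lemma coef_prod_root_of_unity t n (z : algC) : n.+1.-primitive_root z ->
  (\prod_(k : 'I_n.+1 | k != ord0) (1 + (z ^+ k / (1 - z ^+ k) ^+ 2) *: 'X))`_t
  = (-1) ^+ t * 'C(n.+1 + t, 2 * t + 1)%:R / (n.+1 * (t + 1))%:R.
Proof.
move=> zP.
pose P := \prod_(1 <= k < n.+1) (1 + (z ^+ k / (1 - z ^+ k) ^+ 2) *: 'X).
rewrite (_ : \prod_(k < _ | _) _ = P); last first.
  by rewrite /P big_add1 /= big_mkord big_mkcond big_ord_recl /= mul1r.
have PE : dcheb algC n.+1 = 'X * (n.+1%:R ^+ 2 *: P).
  rewrite -(prod_root_of_unity_quadratic zP) big_ltn // expr0 subrr.
  rewrite expr0n /= scale1r add0r.
  rewrite -(prod_1subroot_of_unity zP) -prodrXl -scaler_prod; congr (_ * _).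
  rewrite big_nat [RHS]big_nat; apply: eq_bigr => k /(prim_root_1sub_neq0 zP) nzk.
  rewrite scalerDr scalerA -alg_polyC; congr (_ + _ *: _).
  by rewrite mulrC divfK // expf_neq0.
have := coef_dcheb_bin algC n.+1 t; rewrite PE mulrC coefMX /= coefZ => E.
have n0 : n.+1%:R != 0 :> algC by rewrite Num.Theory.pnatr_eq0.
have t0 : t.+1%:R != 0 :> algC by rewrite Num.Theory.pnatr_eq0.
apply: (mulfI (expf_neq0 2 n0)); rewrite E natrM (addn1 t).
by move: (n.+1%:R) (t.+1%:R) n0 t0 => c d c0 d0; field; rewrite d0 c0.
Qed.

(** * Evaluation of rational functions at an algebraic number *)

Definition intpoly_eval (z : algC) (f : {poly int}) : algC := (map_poly intr f).[z].

(* [A] is regular at [z], with value [a]. *)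
Definition frac_eval (z : algC) (A : ratfun) (a : algC) : Prop :=
  exists f g : {poly int}, [/\ intpoly_eval z g != 0, A = tofrac f / tofrac g
    & a = intpoly_eval z f / intpoly_eval z g].

Lemma map_qnat_poly (R : nzRingType) n :
  map_poly intr (qnat_poly n) = \sum_(i < n) 'X^i :> {poly R}.
Proof. by rewrite rmorph_sum; apply: eq_bigr => i _; rewrite /= map_polyXn. Qed.

Lemma horner_qnat_poly (R : nzRingType) n (x : R) :
  (map_poly intr (qnat_poly n)).[x] = \sum_(i < n) x ^+ i.
Proof.
rewrite map_qnat_poly horner_sum; apply: eq_bigr => i _.
by rewrite hornerXn.
Qed.

Section Eval.
Variable z : algC.
Notation ev := (intpoly_eval z).

Lemma intpoly_evalM f g : ev (f * g) = ev f * ev g.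
Proof. by rewrite /intpoly_eval rmorphM hornerM. Qed.

Lemma intpoly_evalD f g : ev (f + g) = ev f + ev g.
Proof. by rewrite /intpoly_eval rmorphD hornerD. Qed.

Lemma intpoly_evalN f : ev (- f) = - ev f.
Proof. by rewrite /intpoly_eval rmorphN hornerN. Qed.

Lemma intpoly_eval1 : ev 1 = 1.
Proof. by rewrite /intpoly_eval rmorph1 hornerC. Qed.

Lemma tofrac_neq0 f : ev f != 0 -> tofrac f != 0.
Proof.
rewrite tofrac_eq0; apply: contraNneq => ->.
by rewrite /intpoly_eval rmorph0 horner0.
Qed.

Lemma frac_eval_poly f : frac_eval z (tofrac f) (ev f).
Proof.
by exists f, 1; split; rewrite ?intpoly_eval1 ?oner_eq0 // ?rmorph1 divr1.
Qed.

Lemma frac_eval1 : frac_eval z 1 1.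
Proof. by rewrite -tofrac1 -intpoly_eval1; exact: frac_eval_poly. Qed.

Lemma frac_evalN A a : frac_eval z A a -> frac_eval z (- A) (- a).
Proof.
case=> f [g [g0 -> ->]]; exists (- f), g.
by rewrite rmorphN intpoly_evalN !mulNr.
Qed.

Lemma frac_evalD A B a b :
  frac_eval z A a -> frac_eval z B b -> frac_eval z (A + B) (a + b).
Proof.
case=> f [g [g0 -> ->]] [f' [g' [g0' -> ->]]]; exists (f * g' + f' * g), (g * g').
rewrite intpoly_evalD !intpoly_evalM; split; first by rewrite mulf_neq0.
- by rewrite tofracD !tofracM addf_div ?tofrac_neq0.
- by rewrite addf_div.
Qed.

Lemma frac_evalM A B a b :
  frac_eval z A a -> frac_eval z B b -> frac_eval z (A * B) (a * b).
Proof.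
case=> f [g [g0 -> ->]] [f' [g' [g0' -> ->]]]; exists (f * f'), (g * g').
rewrite !intpoly_evalM; split; first by rewrite mulf_neq0.
- by rewrite !tofracM mulf_div.
- by rewrite mulf_div.
Qed.

(** A nonzero value means that the numerator does not vanish at [z], so it can serve as
    denominator. *)
Lemma frac_evalV A a : a != 0 -> frac_eval z A a -> frac_eval z A^-1 a^-1.
Proof.
move=> + [f [g [g0 -> aE]]]; rewrite {}aE mulf_eq0 invr_eq0 negb_or => /andP[f0 _].
by exists g, f; split=> //; rewrite invf_div.
Qed.

Lemma frac_evalX A a n : frac_eval z A a -> frac_eval z (A ^+ n) (a ^+ n).
Proof.
move=> Aa; elim: n => [|n IH]; first by rewrite !expr0; exact: frac_eval1.
by rewrite !exprS; exact: frac_evalM.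
Qed.

Lemma frac_eval_nat n : frac_eval z n%:R n%:R.
Proof.
have -> : (n%:R : ratfun) = tofrac n%:R by rewrite rmorph_nat.
have -> : (n%:R : algC) = ev n%:R.
  by rewrite /intpoly_eval rmorph_nat -polyC_natr hornerC.
exact: frac_eval_poly.
Qed.

Lemma frac_eval_sum (I : finType) (P : pred I) (A : I -> ratfun) (a : I -> algC) :
    (forall i, P i -> frac_eval z (A i) (a i)) ->
  frac_eval z (\sum_(i | P i) A i) (\sum_(i | P i) a i).
Proof.
move=> Aa; apply: (big_rec2 (fun B b => frac_eval z B b)) => [|i B b Pi].
  exact: (frac_eval_nat 0).
exact/frac_evalD/Aa.
Qed.

Lemma frac_eval_prod (I : finType) (P : pred I) (A : I -> ratfun) (a : I -> algC) :
    (forall i, P i -> frac_eval z (A i) (a i)) ->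
  frac_eval z (\prod_(i | P i) A i) (\prod_(i | P i) a i).
Proof.
move=> Aa; apply: (big_rec2 (fun B b => frac_eval z B b)) => [|i B b Pi].
  exact: frac_eval1.
exact/frac_evalM/Aa.
Qed.

Lemma frac_eval_qvar : frac_eval z qvar z.
Proof.
have := frac_eval_poly 'X; by rewrite /intpoly_eval map_polyX hornerX.
Qed.

Lemma frac_eval_qnat n : frac_eval z (qnat n) (\sum_(i < n) z ^+ i).
Proof.
by rewrite -horner_qnat_poly; exact: frac_eval_poly.
Qed.

End Eval.

(** * From equal values at a root of unity to congruence modulo [[p]_q] *)

(** For prime [p] the cyclotomic product omits only the exponent 0, that is, the factor X - 1 of X^p
    - 1. *)
Lemma minCpoly_prime_root p (z : algC) : prime p -> p.-primitive_root z ->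
  minCpoly z = map_poly intr (qnat_poly p).
Proof.
move=> p_pr zP; rewrite (minCpoly_cyclotomic zP) /cyclotomic.
have p0 := prime_gt0 p_pr.
have := factor_Xn_sub_1 zP; rewrite big_ltn // expr0 subrX1.
move/(mulfI (monic_neq0 (monicXsubC 1))).
rewrite map_qnat_poly => <-.
rewrite -(big_mkord (fun k => coprime k p) (fun k => 'X - (z ^+ k)%:P)).
have cop0 : coprime 0 p = false by rewrite /coprime gcd0n (gtn_eqF (prime_gt1 p_pr)).
rewrite big_ltn_cond // cop0.
rewrite big_nat_cond [RHS]big_nat; apply: eq_bigl => k.
case: (boolP (0 < k < p)%N) => [/andP[k0 kp]|//].
by rewrite /= coprime_sym prime_coprime //;
  apply/negP=> /(dvdn_leq k0); rewrite leqNgt kp.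
Qed.

Lemma map_to_Qpoly (f : {poly int}) :
  map_poly (ratr : rat -> algC) (to_Qpoly f) = map_poly intr f.
Proof.
rewrite /to_Qpoly -map_poly_comp; apply: eq_map_poly => m; exact: ratr_int.
Qed.

(** The order of [w] divides [p], and it is not 1 because [[p]_q] takes the value [p] at 1. *)
Lemma root_qnat_poly p (w : algC) : prime p ->
  root (map_poly intr (qnat_poly p)) w -> p.-primitive_root w.
Proof.
move=> p_pr; rewrite /root horner_qnat_poly => /eqP wp.
have w1 : w ^+ p = 1 by apply/eqP; rewrite -subr_eq0 subrX1 wp mulr0.
have [k kP kp] := prim_order_exists (prime_gt0 p_pr) w1.
have [k1|k1] := eqVneq k 1%N; last first.
  by move: kP; have /primeP[_ /(_ _ kp)] := p_pr; rewrite (negPf k1) => /eqP ->.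
have w_eq1 : w = 1 by have := prim_expr_order kP; rewrite k1.
move/eqP: wp; rewrite w_eq1 (eq_bigr (fun _ => 1)) => [|i _]; last by rewrite expr1n.
by rewrite sumr_const card_ord Num.Theory.pnatr_eq0 -leqn0 leqNgt prime_gt0.
Qed.

(** [[p]_q] is the minimal polynomial of every primitive [p]-th root. As the left side does not
    mention [w], vanishing passes from one such root to another. *)
Lemma dvdp_qnat p (w : algC) (f : {poly int}) : prime p -> p.-primitive_root w ->
  (to_Qpoly (qnat_poly p) %| to_Qpoly f) = (intpoly_eval w f == 0).
Proof.
move=> p_pr wP; have [m [mE _ mP]] := minCpolyP w.
rewrite -[RHS]/(root _ w) -map_to_Qpoly mP; congr (_ %| _).
apply: (map_poly_inj (ratr : {rmorphism rat -> algC})).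
by rewrite /= -mE (minCpoly_prime_root p_pr wP) map_to_Qpoly.
Qed.

Lemma eqmod_of_frac_eval p (z : algC) A B a : prime p -> p.-primitive_root z ->
  frac_eval z A a -> frac_eval z B a -> ratfun_eqmod (qnat_poly p) A B.
Proof.
move=> p_pr zP Aa Ba.
have [f [g [g0 AB /esym/eqP]]] := frac_evalD Aa (frac_evalN Ba).
rewrite subrr mulf_eq0 invr_eq0 (negPf g0) orbF => f0.
exists f, g; split=> //; last by rewrite (dvdp_qnat _ p_pr zP).
  by apply: contraNneq g0 => ->; rewrite /intpoly_eval rmorph0 horner0.
rewrite -(coprimep_map (ratr : {rmorphism rat -> algC})) coprimep_sym.
(* A common root [w] of [g] and [[p]_q] would be primitive, forcing [g] to vanish at [z] as well. *)
rewrite !map_to_Qpoly; apply/Pdiv.ClosedField.coprimepP => w /(root_qnat_poly p_pr) wP.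
apply: contra g0; rewrite -!/(intpoly_eval _ g).
by rewrite -(dvdp_qnat _ p_pr wP) -(dvdp_qnat _ p_pr zP).
Qed.

Theorem theorem4p1 (t p : nat) (ht : (1 <= t)%N) (hp : prime p)
    (htp : (t < p)%N) :
  ratfun_eqmod (qnat_poly p)
    (qmhs p.-1 (nseq_tuple t 2%N))
    ((-1) ^+ t * 'C(p + t, 2 * t + 1)%:R * (1 - qvar) ^+ (2 * t)
       / (p * (t + 1))%:R).
Proof.
have p0 := prime_gt0 hp.
have [z zP] := C_prim_root_exists p0.
pose F (k : nat) : algC := z ^+ k / (1 - z ^+ k) ^+ 2.
apply: (eqmod_of_frac_eval hp zP (a :=
  \sum_(k : t.-tuple 'I_p.-1.+1 | path ltn 0 (map val k))
    \prod_(i < t) ((1 - z) ^+ 2 * F (tnth k i)))).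
  (* As 0 < k < p, [[k]_q] has the nonzero value (1 - z^k)/(1 - z) at [z], which turns each factor
     into (1 - z)^2 F(k). *)
  apply: frac_eval_sum => k k_inc; apply: frac_eval_prod => i _.
  have /andP[k0 kp] : (0 < tnth k i < p)%N.
    apply/andP; split; last by apply: leq_trans (ltn_ord _) _; rewrite prednK.
    move: k_inc; rewrite (path_sortedE ltn_trans) => /andP[/allP + _]; apply.
    by rewrite map_f // mem_tnth.
  have zk : 1 - z ^+ tnth k i != 0 by rewrite (prim_root_1sub_neq0 zP) // k0.
  have z1 : 1 - z != 0.
    by rewrite -[z]expr1 (prim_root_1sub_neq0 zP) // prime_gt1.
  rewrite tnth_nseq /= mul1n.
  have qE : \sum_(j < tnth k i) z ^+ j = (1 - z ^+ tnth k i) / (1 - z).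
    by apply: (mulIf z1); rewrite divfK // -[RHS]opprB subrX1 -mulNr opprB mulrC.
  have -> : (1 - z) ^+ 2 * F (tnth k i)
      = z ^+ tnth k i / (\sum_(j < tnth k i) z ^+ j) ^+ 2.
    by rewrite qE /F; field; rewrite z1 zk.
  apply: frac_evalM; first exact/frac_evalX/frac_eval_qvar.
  apply: frac_evalV; first by rewrite qE expf_neq0 // mulf_neq0 // invr_eq0.
  exact/frac_evalX/frac_eval_qnat.
have -> : \sum_(k : t.-tuple 'I_p.-1.+1 | path ltn 0 (map val k))
    \prod_(i < t) ((1 - z) ^+ 2 * F (tnth k i)) =
   (-1) ^+ t * 'C(p + t, 2 * t + 1)%:R * (1 - z) ^+ (2 * t) / (p * (t + 1))%:R.
  (* The [t] factors give (1 - z)^(2t); the remaining sum is the coefficient of degree [t] in the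
     product over 0 < k < p. *)
  under eq_bigr do rewrite big_split /= prodr_const card_ord -exprM.
  rewrite -mulr_sumr (sum_ltn_tuplesE t (fun k : 'I__ => F k)).
  rewrite coef_prod_root_of_unity ?prednK //.
  by rewrite mulrCA !mulrA; ring.
apply: frac_evalM; last first.
  apply: frac_evalV (frac_eval_nat _ _).
  by rewrite Num.Theory.pnatr_eq0 muln_eq0 addn1 orbF -lt0n.
have ev1 := frac_eval1 z.
apply: frac_evalM; last exact/frac_evalX/(frac_evalD ev1)/frac_evalN/frac_eval_qvar.
by apply: frac_evalM (frac_eval_nat _ _); apply/frac_evalX/frac_evalN.
Qed.
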